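(* Let $p$ be an odd prime, $q$ a power of $p$, and $k$ an integer with $0\le k\le p-1$. Let $B(z)=(2-k+(k-1)z)\big(-1-(z-z^q)^{q-1}\big)\in\mathbb{F}_q[z]$ and define $c_1,\dots,c_{q^2+q-1}\in\mathbb{F}_q$ by $$\sum_{i=1}^{q^2+q-1}c_iz^i=(1+z^{q-1}-z^q)\sum_{i=1}^{q^2-1}z^i-\Big(z^{2(q-1)}+\sum_{m=1}^{q-1}(z-1)^{q-1-m}z^{2m}\Big(\frac14\Big)^m\Big)B(z).$$ Then, with all quantities computed in $\mathbb{F}_q$: (i) $\sum_{a\in\mathbb{F}_q}D_{j,k}(1,a)=-c_j+\frac{k(j-1)+2}{2^j}$ for $1\le j\le q-1$; (ii) $\sum_{a\in\mathbb{F}_q}D_{q,k}(1,a)=c_1-c_q+\frac{2-k}{2^q}$; (iii) for $1\le l\le q-2$ and $1\le j\le q-1$, $$\sum_{a\in\mathbb{F}_q}D_{lq+j,k}(1,a)=\sum_{a\in\mathbb{F}_q}D_{(l-1)q+j,k}(1,a)-\sum_{a\in\mathbb{F}_q}D_{(l-1)q+j+1,k}(1,a)-c_{lq+j}+\frac{(kj+2)(1-2^q+2^{q-1})+k(2^q-1)}{2^{lq+j}};$$ (iv) for $2\le l\le q-2$, $$\sum_{a\in\mathbb{F}_q}D_{lq,k}(1,a)=\sum_{a\in\mathbb{F}_q}D_{(l-1)q,k}(1,a)-\sum_{a\in\mathbb{F}_q}D_{(l-1)q+1,k}(1,a)-c_{lq}+\frac{(k-2)(2^q-1)+2^q}{2^{lq}};$$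 (v) for $0\le j\le q-1$, $\sum_{a\in\mathbb{F}_q}D_{q^2-q+j,k}(1,a)=\sum_{i=j}^{q-1}c_{q^2+i}+\frac{k(j-1)+2}{2^{q^2-q+j}}$.
   Context: For an integer $n\ge1$, $D_{n,k}(1,x)=\sum_{i=0}^{\lfloor n/2\rfloor}\frac{n-ki}{n-i}\binom{n-i}{i}(-x)^i\in\mathbb{F}_q[x]$ (the coefficients are integers, reduced mod $p$), and $D_{0,k}(1,x)=2-k$. *)

(* Defs.v *)
From HB Require Import structures.
From mathcomp Require Import all_boot all_order all_algebra.
From mathcomp Require Import zify.
Set Implicit Arguments.
Unset Strict Implicit.
Unset Printing Implicit Defensive.
Import Order.TTheory GRing.Theory Num.Theory.
Local Open Scope ring_scope.

(* The integer (n - k i) / (n - i) * 'C(n - i, i); for n > 0 and i <= n / 2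
   the division is exact, see dickson_coefE. *)
Definition dickson_coef (k n i : nat) : int :=
  (((n%:Z - k%:Z * i%:Z) * ('C(n - i, i))%:Z) %/ (n - i)%N%:Z)%Z.

Lemma dickson_coefE (k n i : nat) : (0 < n)%N -> (i <= n./2)%N ->
  dickson_coef k n i * (n - i)%N%:Z
    = (n%:Z - k%:Z * i%:Z) * ('C(n - i, i))%:Z.
Proof.
move=> n0 hi; rewrite /dickson_coef divzK //.
case: i hi => [|i] hi.
  by rewrite subn0 bin0 mulr0 subr0 mulr1 dvdzz.
have hlt : (i.+1 < n)%N by lia.
have [m hm] : exists m, (n - i.+1 = m.+1)%N.
  by exists (n - i.+1).-1; lia.
rewrite hm.
have hb : (i.+1%:Z * ('C(m.+1, i.+1))%:Z = m.+1%:Z * ('C(m, i))%:Z).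
  by rewrite -!PoszM mul_bin_diag.
have -> : n%:Z - k%:Z * i.+1%:Z = m.+1%:Z + (1 - k%:Z) * i.+1%:Z by lia.
rewrite mulrDl -mulrA hb mulrCA -mulrDr.
exact: dvdz_mulr.
Qed.

(* D_{n,k}(1,x), the n-th reversed Dickson polynomial of the (k+1)-th kind. *)
Definition dickson_rev (F : fieldType) (k n : nat) : {poly F} :=
  if n == 0%N then (2%:R - k%:R)%:P
  else \sum_(i < n./2.+1) (dickson_coef k n i)%:~R *: (- 'X) ^+ i.

Definition polyB (F : fieldType) (q k : nat) : {poly F} :=
  ((2%:R - k%:R)%:P + (k%:R - 1)%:P * 'X) * (- 1 - ('X - 'X^q) ^+ (q - 1)).

Definition polyC_gen (F : fieldType) (q k : nat) : {poly F} :=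
  (1 + 'X^(q - 1) - 'X^q) * \sum_(1 <= i < q ^ 2) 'X^i
  - ('X^(2 * (q - 1))
     + \sum_(1 <= m < q)
         ('X - 1) ^+ (q - 1 - m) * 'X^(2 * m) * ((4%:R^-1) ^+ m)%:P)
    * polyB F q k.

(* The defining identity of the c_i is satisfiable. *)
Lemma polyC_gen_coefs (F : fieldType) (q k : nat) : (1 < q)%N ->
  \sum_(1 <= i < q ^ 2 + q) (polyC_gen F q k)`_i *: 'X^i = polyC_gen F q k.
Proof.
move=> q1; set P := polyC_gen F q k.
have c0 : P`_0 = 0.
  have X0 n : (0 < n)%N -> ('X^n : {poly F}).[0] = 0.
    by move=> n0; rewrite hornerXn expr0n; case: n n0.
  have Z1 n : (\sum_(1 <= i < n) 'X^i : {poly F}).[0] = 0.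
    rewrite horner_sum big_nat_cond big1 // => i.
    by rewrite andbT => /andP[i0 _]; exact: X0.
  have Z2 : (\sum_(1 <= m < q)
      ('X - 1) ^+ (q - 1 - m) * 'X^(2 * m) * ((4%:R^-1) ^+ m)%:P : {poly F}).[0]
      = 0.
    rewrite horner_sum big_nat_cond big1 // => i.
    rewrite andbT => /andP[i0 _].
    by rewrite !hornerM X0 ?mulr0 ?mul0r //; lia.
  rewrite -horner_coef0 /P /polyC_gen hornerD hornerN.
  rewrite [X in X - _]hornerM [X in _ - X]hornerM [X in _ - X * _]hornerD.
  rewrite Z1 Z2 X0; last by lia.
  by rewrite addr0 mulr0 mul0r subr0.
have sX n : size ('X^n : {poly F}) = n.+1 by rewrite size_polyXn.
have sD (a b : {poly F}) n : (size a <= n -> size b <= n -> size (a + b)%R <= n)%N.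
  by move=> ha hb; apply: (leq_trans (size_polyD a b)); rewrite geq_max ha hb.
have sM (a b : {poly F}) m n l :
    (size a <= m.+1 -> size b <= n.+1 -> m + n <= l -> size (a * b)%R <= l.+1)%N.
  by move=> ha hb hl; apply: (leq_trans (size_polyMleq _ _)); lia.
have sE (a : {poly F}) m n : (size a <= m.+1 -> size (a ^+ n)%R <= (m * n).+1)%N.
  move=> ha; elim: n => [|n IH]; first by rewrite expr0 size_poly1.
  by rewrite exprS; apply: (sM _ _ m (m * n)%N) => //; lia.
have sC (a : F) n : (size (a%:P) <= n.+1)%N.
  by apply: (leq_trans (size_polyC_leq1 _)).
have s1 n : (size (1%R : {poly F}) <= n.+1)%N by rewrite size_poly1.
have sP : (size P <= q ^ 2 + q)%N.
  have -> : (q ^ 2 + q = (q ^ 2 + q - 1).+1)%N by lia.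
  apply: (sD); last rewrite size_polyN.
    apply: (sM _ _ q (q ^ 2 - 1)%N); last by lia.
      apply: (sD); last by rewrite size_polyN sX.
      by apply: (sD) => //; rewrite sX; lia.
    rewrite big_nat_cond; elim/big_ind: _ => [|a b|i]; first by rewrite size_poly0.
      exact: (sD).
    by rewrite andbT sX => /andP[]; lia.
  apply: (sM _ _ (2 * (q - 1))%N (q ^ 2 - q + 1)%N); last by nia.
    apply: (sD); first by rewrite sX.
    rewrite big_nat_cond; elim/big_ind: _ => [|a b|i]; first by rewrite size_poly0.
      exact: (sD).
    rewrite andbT => /andP[i0 iq].
    apply: (sM _ _ (2 * (q - 1))%N 0%N) => //; last by lia.
    apply: (sM _ _ (1 * (q - 1 - i))%N (2 * i)%N); [|by rewrite sX|by lia].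
    by apply: (sE); apply: (sD); rewrite ?size_polyX ?size_polyN.
  apply: (sM _ _ 1%N (q * (q - 1))%N); last by nia.
    apply: (sD); first exact: (sC).
    by apply: (sM _ _ 0%N 1%N); rewrite ?size_polyX ?sC.
  apply: (sD); rewrite ?size_polyN //; apply: (sE); apply: (sD).
    by rewrite size_polyX; lia.
  by rewrite size_polyN sX.
rewrite -[RHS]coefK (poly_def (size P)).
rewrite -(big_mkord xpredT (fun i => P`_i *: 'X^i)).
rewrite (big_nat_widen 0 (size P) (q ^ 2 + q)) //=.
rewrite [RHS]big_mkcond [RHS]big_ltn ?addn_gt0 ?expn_gt0 ?(ltnW q1) //.
rewrite /= c0 scale0r if_same add0r; apply: eq_bigr => i _.
by case: ltnP => // hi; rewrite nth_default ?scale0r.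
Qed.

(* Main.v *)
Require Import Defs.
From HB Require Import structures.
From mathcomp Require Import all_boot all_order all_algebra.
From mathcomp Require Import all_field.
From mathcomp Require Import ring zify.
Import Order.TTheory GRing.Theory Num.Theory.
Local Open Scope ring_scope.

(* The sequence [D_n = D_{n,k}(1,a)] satisfies [D_{n+2} = D_{n+1} - a D_n], so its
   generating function is [A(z) / (1 - z + a z^2)] with [A = 2 - k + (k-1) z].
   For [a = 1/4] the denominator is [w^2], [w = 1 - z/2], and
   [D_n(1/4) = (k(n-1) + 2) / 2^n]: these are the closed-form terms of the theorem.
   For [a = 1/4 + b], [b != 0], it is [w^2 + b z^2], a divisor of
   [1 - z^(q^2-1)], so [D_n] has period [q^2 - 1] from [n = 1] on and
   [sum_{0<n<q^2} D_n z^n = (1 - z^(q^2-1)) (A / (w^2 + b z^2) - (2 - k))].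
   The product of the [w^2 + b z^2] is [w^(2(q-1)) - z^(2(q-1))], and Frobenius
   gives [w^2] times this as [(1 - z^(q-1)) (1 + z^(q-1) - z^q)]; moreover
   [sum_b 1 / (w^2 + b z^2) = - w^(2(q-2)) / (w^(2(q-1)) - z^(2(q-1)))].
   Hence the polynomial of the [c_i] is [- (1 + z^(q-1) - z^q)] times the
   generating polynomial of [T_n = sum_{a != 1/4} D_n(a)], and the five formulas
   compare coefficients, using [2^q = 2]. *)

(** * Power sums and Frobenius over a finite field *)

(** Some [x != 0] has [x ^+ i != 1], as ['X^i - 1] has at most [i] roots; multiplication by [x]
    permutes the nonzero elements and scales the sum by [x ^+ i]. *)
Lemma sum_expf_neq0 (F : finFieldType) (i : nat) :
  (0 < i < #|F|.-1)%N -> \sum_(b : F | b != 0) b ^+ i = 0.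
Proof.
case/andP=> i_gt0 i_lt.
have [x /andP[x0 xi]] : exists x : F, (x != 0) && (x ^+ i != 1).
  apply/existsP; apply: contraLR i_lt; rewrite negb_exists -leqNgt => /forallP all1.
  have P0 : 'X^i - 1 != 0 :> {poly F} by rewrite -size_poly_eq0 size_XnsubC.
  have := @max_poly_roots F _ (enum (predC1 (0 : F))) P0.
  rewrite size_XnsubC // ltnS -cardE cardC1; apply; last exact: enum_uniq.
  apply/allP=> y; rewrite mem_enum inE => y0.
  by have := all1 y; rewrite y0 /= negbK rootE !hornerE => /eqP ->; rewrite subrr.
set s := \sum_(_ | _) _.
have : x ^+ i * s = s.
  rewrite /s [RHS](reindex_inj (mulfI x0)) big_distrr /=.
  apply: eq_big => b; first by rewrite mulf_eq0 negb_or x0.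
  by rewrite exprMn.
move/eqP; rewrite -subr_eq0 -{2}[s]mul1r -mulrBl mulf_eq0 subr_eq0 (negPf xi).
by move/eqP.
Qed.

Lemma expf_card_pred (F : finFieldType) (b : F) :
  b != 0 -> b ^+ #|F|.-1 = 1.
Proof.
move=> b0; apply: (mulfI b0); rewrite -exprS mulr1 prednK ?expf_card //.
by rewrite (leq_trans _ (finNzRing_gt1 F)).
Qed.

Lemma poly_expq_add (F : finFieldType) (f g : {poly F}) :
  (f + g) ^+ #|F| = f ^+ #|F| + g ^+ #|F|.
Proof.
have [p p_pr pF] := finPcharP F.
apply: exprDn_pchar; rewrite (card_pprimeChar pF) pnatX pnatE ?pchar_poly ?pF //.
Qed.

Lemma poly_expq_sub (F : finFieldType) (f g : {poly F}) :
  (f - g) ^+ #|F| = f ^+ #|F| - g ^+ #|F|.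
Proof.
have E : g ^+ #|F| + (- g) ^+ #|F| = 0.
  rewrite -poly_expq_add subrr expr0n.
  by have := finNzRing_gt1 F; case: #|F|.
by rewrite poly_expq_add -[(- g) ^+ _]add0r -(addNr (g ^+ #|F|)) -addrA E addr0.
Qed.

(** * The three-term recurrence and the value at 1/4 *)

(** With [m.+1 = n - i.+1], split [n - k * i.+1 = m.+1 + (1 - k) * i.+1] and absorb [i.+1] into the
    binomial; the division by [m.+1] then becomes visible. *)
Lemma dickson_coefS (k n i : nat) : (i.+1 <= n./2)%N ->
  dickson_coef k n i.+1
    = ('C(n - i.+1, i.+1))%:Z + (1 - k%:Z) * ('C((n - i.+1).-1, i))%:Z.
Proof.
move=> hi; have n0 : (0 < n)%N by lia.
have [m hm] : exists m, (n - i.+1 = m.+1)%N by exists (n - i.+1).-1; lia.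
have nz : m.+1%:Z != 0 by [].
apply: (mulIf nz); rewrite -hm dickson_coefE // hm /=.
have hb : (i.+1%:Z * ('C(m.+1, i.+1))%:Z = m.+1%:Z * ('C(m, i))%:Z).
  by rewrite -!PoszM mul_bin_diag.
have -> : n%:Z - k%:Z * i.+1%:Z = m.+1%:Z + (1 - k%:Z) * i.+1%:Z by lia.
by rewrite mulrDl -[_ * i.+1%:Z * _]mulrA hb; ring.
Qed.

Lemma dickson_coef0 (k n : nat) : (0 < n)%N -> dickson_coef k n 0 = 1.
Proof.
move=> n0; rewrite /dickson_coef subn0 mulr0 subr0 bin0 mulr1.
by rewrite divzz; case: n n0.
Qed.

(** This is the case [k = 1], of Fibonacci type. The terms beyond [n./2] vanish; keeping them makes
    Pascal's rule a plain shift of the index. *)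
Definition fib_eval (F : fieldType) (n : nat) (a : F) : F :=
  \sum_(i < n.+1) ('C(n - i, i))%:R * (- a) ^+ i.

Lemma fib_evalS (F : fieldType) (n : nat) (a : F) :
  fib_eval F n.+1 a = 1 + \sum_(i < n.+1) ('C(n - i, i.+1))%:R * (- a) ^+ i.+1.
Proof.
by rewrite /fib_eval big_ord_recl /= bin0 mul1r expr0; congr (_ + _).
Qed.

Lemma fib_eval_rec (F : fieldType) (n : nat) (a : F) :
  fib_eval F n.+2 a = fib_eval F n.+1 a - a * fib_eval F n a.
Proof.
rewrite 2!fib_evalS -addrA; congr (_ + _).
rewrite big_ord_recr /= subnn bin0n mul0r addr0 /fib_eval big_distrr /= -sumrB.
apply: eq_bigr => i _; rewrite subSn; last by have := ltn_ord i; lia.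
by rewrite binS natrD exprS; ring.
Qed.

Lemma fib_eval_trunc (F : fieldType) (n N : nat) (a : F) : (n./2 < N)%N -> (N <= n.+1)%N ->
  \sum_(i < N) ('C(n - i, i))%:R * (- a) ^+ i = fib_eval F n a.
Proof.
move=> h1 h2; rewrite /fib_eval (big_ord_widen _ (fun i => ('C(n - i, i))%:R * (- a) ^+ i) h2).
rewrite [RHS](bigID (fun i : 'I__ => (i < N)%N)) /= [X in _ = _ + X]big1 ?addr0 //.
by move=> i hi; rewrite bin_small ?mul0r //; have := ltn_ord i; lia.
Qed.

Lemma dickson_rev_fib (F : fieldType) (k n : nat) (a : F) :
  (dickson_rev F k n.+2).[a] = fib_eval F n.+2 a - (1 - k%:R) * a * fib_eval F n a.
Proof.
rewrite /dickson_rev /= horner_sum -(@fib_eval_trunc _ n.+2 n./2.+2) /=; [|lia..].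
rewrite -(@fib_eval_trunc _ n n./2.+1); [|lia..].
rewrite [LHS]big_ord_recl [X in _ = X - _]big_ord_recl dickson_coef0 //= bin0.
rewrite !hornerE -addrA.
congr (_ + _); rewrite big_distrr -sumrB; apply: eq_bigr => i _ /=.
rewrite /bump /= add1n hornerZ horner_exp !hornerE dickson_coefS; last by have := ltn_ord i; lia.
rewrite !subSS subSn; last by have := ltn_ord i; lia.
rewrite rmorphD rmorphM rmorphB rmorph1 /= !pmulrn exprS; ring.
Qed.

Lemma dickson_rev0 (F : fieldType) (k : nat) (a : F) :
  (dickson_rev F k 0).[a] = 2%:R - k%:R.
Proof. by rewrite /dickson_rev hornerC. Qed.

Lemma dickson_rev1 (F : fieldType) (k : nat) (a : F) : (dickson_rev F k 1).[a] = 1.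
Proof. by rewrite /dickson_rev big_ord1 dickson_coef0 // !hornerE. Qed.

Lemma dickson_rev_rec (F : fieldType) (k n : nat) (a : F) :
  (dickson_rev F k n.+2).[a]
    = (dickson_rev F k n.+1).[a] - a * (dickson_rev F k n).[a].
Proof.
have f0 : fib_eval F 0 a = 1 by rewrite /fib_eval big_ord1 bin0 mul1r.
have f1 : fib_eval F 1 a = 1 by rewrite fib_evalS big_ord1 subnn bin0n mul0r addr0.
(* [dickson_rev_fib] starts at index 2, so the recurrences involving index 0 or 1 are checked
   apart. *)
case: n => [|[|n]].
- by rewrite dickson_rev_fib dickson_rev0 dickson_rev1 fib_eval_rec f0 f1; ring.
- by rewrite !dickson_rev_fib dickson_rev1 !fib_eval_rec f0 f1; ring.
- by rewrite !dickson_rev_fib !fib_eval_rec; ring.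
Qed.

(** At 1/4 the characteristic polynomial has the double root 1/2, so the solution is a linear
    function of [n] over [2 ^ n]. *)
Lemma dickson_rev_quarter (F : fieldType) (k n : nat) : 2%:R != 0 :> F ->
  (dickson_rev F k n).[4%:R^-1] = (k%:R * (n%:R - 1) + 2%:R) / 2%:R ^+ n.
Proof.
move=> nz2; have nz4 : 4%:R != 0 :> F by rewrite (natrM _ 2 2) mulf_neq0.
elim/ltn_ind: n => -[|[|n]] IH.
- by rewrite dickson_rev0 expr0 divr1; ring.
- by rewrite dickson_rev1 subrr mulr0 add0r expr1 divff.
rewrite dickson_rev_rec !IH // -[n.+2%:R]natr1 -[n.+1%:R]natr1 !exprS; field.
by rewrite expf_neq0 ?nz2 ?nz4.
Qed.

(** * The generating polynomial over one period *)

Lemma dickson_rev_period_poly (F : fieldType) (k M : nat) (a : F) (h : {poly F}) :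
    (0 < M)%N -> (1 - 'X + a%:P * 'X^2) * h = 1 - 'X^M ->
  ((2%:R - k%:R)%:P + (k%:R - 1)%:P * 'X) * h - (2%:R - k%:R)%:P * (1 - 'X^M)
    = \poly_(n < M.+1) (if n == 0%N then 0 else (dickson_rev F k n).[a]).
Proof.
move=> M_gt0 gh; have [d dE] : exists d : F, d = 2%:R - k%:R by eexists.
have kd : k%:R - 1 = 1 - d :> F by rewrite dE; ring.
rewrite -dE kd polyCB; set W : {poly F} := LHS.
have gW : (1 - 'X + a%:P * 'X^2) * W = (1 - 'X^M) * ('X - (a * d)%:P * 'X^2).
  have -> : (1 - 'X + a%:P * 'X^2) * W
    = ((1 - 'X + a%:P * 'X^2) * h) * (d%:P + (1 - d%:P) * 'X)
      - (1 - 'X + a%:P * 'X^2) * d%:P * (1 - 'X^M).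
    by rewrite /W; ring.
  by rewrite gh polyCM; move: (a%:P) d%:P => u v; ring.
clearbody W.
(* Solved for [W], the product formula reads coefficientwise as the recurrence; the terms with
   ['X^M] only matter in degrees above [M]. *)
have WE : W = W * 'X - a%:P * (W * 'X^2) + 'X - (a * d)%:P * 'X^2
              - ('X - (a * d)%:P * 'X^2) * 'X^M.
  transitivity (W * 'X - a%:P * (W * 'X^2) + (1 - 'X + a%:P * 'X^2) * W); first by ring.
  by rewrite gW; move: a%:P (_ %:P) => u v; ring.
have W0 : W`_0 = 0.
  by rewrite WE !(coefD, coefN, coefCM, coefMX, coefMXn, coefX, coefXn) M_gt0 /=; ring.
have W1 : W`_1 = 1.
  rewrite WE !(coefD, coefN, coefCM, coefMX, coefMXn, coefX, coefXn) /= W0.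
  case: ltnP => [_|hM]; first by ring.
  have -> : M = 1%N by lia.
  by rewrite subnn /=; ring.
(* The last term restores the initial value [d], since [W] has constant coefficient 0. *)
have Wn n : (n.+2 <= M)%N -> W`_n.+2 = W`_n.+1 - a * W`_n - (n == 0%N)%:R * a * d.
  move=> hn; rewrite {1}WE !(coefD, coefN, coefCM, coefMX, coefMXn, coefX, coefXn) /=.
  rewrite ?subSS ?subn0.
  case: ltnP => [_|hM].
    by case: n {hn} => [|n] /=; ring.
  have -> : (n.+2 - M)%N = 0%N by lia.
  by case: n {hn hM} => [|n] /=; ring.
have WD n : (n < M)%N -> W`_n.+1 = (dickson_rev F k n.+1).[a].
  elim/ltn_ind: n => -[|[|n]] IH hn.
  - by rewrite W1 dickson_rev1.
  - by rewrite Wn // W0 W1 dickson_rev_rec dickson_rev1 dickson_rev0 -dE /=; ring.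
  - by rewrite Wn // !IH //= ?[RHS]dickson_rev_rec ?mul0r ?subr0 //; lia.
apply/polyP=> -[|n]; rewrite coef_poly /= ?W0 // ltnS.
case: ltnP => [|hn]; first exact: WD.
rewrite nth_default //; apply: (@leq_trans M.+1) => {n hn} //.
have [->|Wnz] := eqVneq W 0; first by rewrite size_poly0.
have s1M : size (1 - 'X^M : {poly F}) = M.+1.
  by rewrite -opprB size_polyN size_XnsubC.
have s1X : size (1 - 'X : {poly F}) = 2.
  by rewrite -opprB size_polyN size_XsubC.
have sgW g Y : g != 0 -> g * W = (1 - 'X^M) * Y -> (size Y <= size g)%N ->
    (size W <= M.+1)%N.
  move=> gnz E; have := size_polyMleq (1 - 'X^M) Y.
  rewrite -E size_mul // s1M; have := size_poly_gt0 g; have := size_poly_gt0 W.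
  by rewrite gnz Wnz; case: (size W) => // u _; case: (size g) => // v _; lia.
have nz (g : {poly F}) n : size g = n.+1 -> g != 0 by rewrite -size_poly_gt0 => ->.
(* The size bound compares both sides of [gW]; for [a = 0] the denominator drops to degree 1, and so
   does the factor on the right. *)
have [a0|anz] := eqVneq a 0.
  move: gW; rewrite a0 !(mul0r, polyC0) addr0 subr0 => gW0.
  by apply: sgW (nz _ _ s1X) gW0 _; rewrite s1X size_polyX.
have sg : size (1 - 'X + a%:P * 'X^2) = 3.
  by rewrite addrC size_polyDl mul_polyC size_scale // size_polyXn ?s1X.
apply: sgW (nz _ _ sg) gW _; rewrite sg.
rewrite (leq_trans (size_polyD _ _)) // size_polyN size_polyX geq_max /=.
by rewrite mul_polyC (leq_trans (size_scale_leq _ _)) ?size_polyXn.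
Qed.

(** * Factorizations built from [w = 1 - z/2] *)

Lemma polyC_half_add (F : fieldType) : 2%:R != 0 :> F ->
  (2%:R^-1)%:P + (2%:R^-1)%:P = 1 :> {poly F}.
Proof. by move=> nz2; rewrite -polyCD -polyC1; congr _%:P; field. Qed.

Definition half_lin (F : fieldType) : {poly F} := 1 - (2%:R^-1)%:P * 'X.

(** Completing the square; the right side is kept as a difference so that [subrXX] applies to its
    powers. *)
Lemma half_lin_sqr (F : fieldType) (b : F) : 2%:R != 0 :> F ->
  1 - 'X + (4%:R^-1 + b)%:P * 'X^2 = half_lin F ^+ 2 - (- b%:P * 'X^2).
Proof.
move=> nz2.
have e2 := polyC_half_add F nz2.
have -> : 4%:R^-1 = 2%:R^-1 * 2%:R^-1 :> F by rewrite -invfM -natrM.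
rewrite -[X in 1 - X]mul1r -{2}e2 /half_lin polyCD polyCM.
by move: (2%:R^-1)%:P b%:P => u v; ring.
Qed.

Lemma half_lin_expq (F : finFieldType) :
  half_lin F ^+ #|F| = 1 - (2%:R^-1)%:P * 'X^#|F|.
Proof.
by rewrite /half_lin poly_expq_sub expr1n exprMn -polyC_exp expf_card.
Qed.

Lemma half_lin_mul_expX (F : finFieldType) :
  half_lin F * half_lin F ^+ #|F|.-1 = 1 - (2%:R^-1)%:P * 'X * 'X^(#|F|.-1).
Proof.
have c1 : #|F| = #|F|.-1.+1 by rewrite prednK // (leq_trans _ (finNzRing_gt1 F)).
by rewrite -exprS -c1 half_lin_expq -mulrA -exprS -c1.
Qed.

(** By Frobenius [w^q = 1 - z^q/2]; the two halves of [z^q] cancel here and add up in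
    [half_lin_mulD]. *)
Lemma half_lin_mulB (F : finFieldType) :
  half_lin F * (half_lin F ^+ #|F|.-1 - 'X^(#|F|.-1)) = 1 - 'X^(#|F|.-1).
Proof.
by rewrite mulrBr half_lin_mul_expX /half_lin; ring.
Qed.

Lemma half_lin_mulD (F : finFieldType) : 2%:R != 0 :> F ->
  half_lin F * (half_lin F ^+ #|F|.-1 + 'X^(#|F|.-1)) = 1 + 'X^(#|F|.-1) - 'X^#|F|.
Proof.
move=> nz2; have c1 : #|F| = #|F|.-1.+1 by rewrite prednK // (leq_trans _ (finNzRing_gt1 F)).
have e2 := polyC_half_add F nz2.
rewrite mulrDr half_lin_mul_expX.
transitivity (1 + 'X^(#|F|.-1)
    - ((2%:R^-1)%:P + (2%:R^-1)%:P) * ('X * 'X^(#|F|.-1)) : {poly F}).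
  by rewrite /half_lin; ring.
by rewrite e2 mul1r -exprS -c1.
Qed.

(* With [w = half_lin], [q = #|F|] and [g_b = w^2 + b z^2 = 1 - z + (1/4 + b) z^2],
   [b] nonzero: [cofE b] is the cofactor of [g_b] in
   [w^(2(q-1)) - z^(2(q-1))] and [cofK] that of the latter in
   [w^(q^2-1) - z^(q^2-1) = (1 - z^(q^2-1)) / w]. *)
Definition cofE (F : finFieldType) (b : F) : {poly F} :=
  \sum_(i < #|F|.-1) (half_lin F ^+ 2) ^+ (#|F|.-2 - i) * (- b%:P * 'X^2) ^+ i.

Definition cofK (F : finFieldType) : {poly F} :=
  \sum_(i < #|F|.+1./2) (half_lin F ^+ #|F|.-1 ^+ 2) ^+ (#|F|.+1./2.-1 - i)
     * ('X^(#|F|.-1) ^+ 2) ^+ i.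

Lemma odd_card_finField (F : finFieldType) : 2%:R != 0 :> F -> odd #|F|.
Proof.
move=> nz2; have [p p_pr pF] := finPcharP F.
rewrite (card_pprimeChar pF) oddX; case: eqP => //= _.
case: (even_prime p_pr) => [p2|-> //]; case/negP: nz2.
by have /andP[_] := pF; rewrite p2.
Qed.

Lemma finField_card_natr (F : finFieldType) : #|F|%:R = 0 :> F.
Proof.
have [p p_pr pF] := finPcharP F; have := finNzRing_gt1 F.
rewrite (card_pprimeChar pF); case: (logn _ _) => // n _.
by rewrite natrX (pcharf0 pF) expr0n.
Qed.

Lemma finField_card_pred_natr (F : finFieldType) : #|F|.-1%:R = -1 :> F.
Proof.
apply/eqP; rewrite -subr_eq0 opprK natr1 prednK ?finField_card_natr //.
exact: ltnW (finNzRing_gt1 F).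
Qed.

Lemma sum_neq0_const (F : finFieldType) (x : {poly F}) : \sum_(b : F | b != 0) x = - x.
Proof.
rewrite (eq_bigl (mem (predC1 (0 : F)))) // sumr_const cardC1.
by rewrite -mulr_natl -(rmorph_nat (@polyC F)) finField_card_pred_natr rmorphN1 mulN1r.
Qed.

(** Since [(-b)^(q-1) = 1], the difference of the powers of order [q-1] is the same for every
    [b]. *)
Lemma cofEP (F : finFieldType) (b : F) : 2%:R != 0 :> F -> b != 0 ->
  (1 - 'X + (4%:R^-1 + b)%:P * 'X^2) * cofE F b
    = (half_lin F ^+ #|F|.-1) ^+ 2 - 'X^(#|F|.-1) ^+ 2.
Proof.
move=> nz2 bnz; rewrite half_lin_sqr // /cofE -subrXX exprAC -polyCN.
rewrite [(_%:P * 'X^2) ^+ _]exprMn -polyC_exp.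
by rewrite expf_card_pred ?oppr_eq0 // mul1r [X in _ - X]exprAC.
Qed.

(** The power sums of [b] kill every term but [i = 0], which occurs [q - 1 = -1] times. *)
Lemma sum_cofE (F : finFieldType) : 2%:R != 0 :> F ->
  \sum_(b : F | b != 0) cofE F b = - (half_lin F ^+ 2) ^+ #|F|.-2.
Proof.
move=> nz2; rewrite /cofE exchange_big /=.
have [m Hm] : exists m, #|F|.-1 = m.+1.
  by case: #|F| (finNzRing_gt1 F) => [|[|m]] // _; exists m.
rewrite Hm big_ord_recl /= subn0 [X in _ + X]big1 ?addr0 => [|i _].
  rewrite (eq_bigr (fun=> (half_lin F ^+ 2) ^+ m)) ?sum_neq0_const // => b _.
  by rewrite expr0 mulr1.
rewrite -big_distrr /= (eq_bigr (fun b : F => (b ^+ (bump 0 i))%:P * (- 'X^2) ^+ (bump 0 i))).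
  rewrite -big_distrl /= -rmorph_sum /= sum_expf_neq0 ?mul0r ?mulr0 //.
  by have := ltn_ord i; rewrite /bump Hm; lia.
by move=> b _; rewrite mulNr -mulrN exprMn polyC_exp.
Qed.

(** As [q] is odd, [2(q-1)] times [(q+1)/2] is [q^2 - 1]; then Frobenius applied twice gives
    [w^(q^2) = 1 - z^(q^2)/2]. *)
Lemma cofKP (F : finFieldType) : 2%:R != 0 :> F ->
  half_lin F * (((half_lin F ^+ #|F|.-1) ^+ 2 - 'X^(#|F|.-1) ^+ 2) * cofK F)
    = 1 - 'X^((#|F| ^ 2).-1).
Proof.
move=> nz2; rewrite /cofK -subrXX.
have odF := odd_card_finField F nz2; have c1 := finNzRing_gt1 F.
set Q := #|F|.-1; set m := #|F|.+1./2.
have Qm : (Q * 2 * m = (#|F| ^ 2).-1)%N.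
  have [n Hn] : exists n, #|F| = (2 * n).+1 by exists #|F|./2; move: #|F| odF => q; lia.
  rewrite /Q /m Hn; have -> : (2 * n).+2./2 = n.+1 by lia.
  by rewrite /=; nia.
have cM : (#|F| * #|F| = (#|F| ^ 2).-1.+1)%N by nia.
rewrite -!exprM Qm mulrBr -exprS -cM exprM.
rewrite half_lin_expq poly_expq_sub expr1n exprMn -polyC_exp expf_card.
by rewrite -exprM cM exprS /half_lin; ring.
Qed.

(** * The ingredients of [polyC_gen] *)

Lemma sub1_mul_sum_expr (R : comNzRingType) (x : R) (n : nat) :
  (1 - x) * \sum_(1 <= i < n.+1) x ^+ i = x * (1 - x ^+ n).
Proof.
elim: n => [|n IH]; first by rewrite big_geq // expr0 subrr !mulr0.
by rewrite big_nat_recr //= mulrDr IH exprS; ring.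
Qed.

Lemma half_lin_neq0 (F : fieldType) : half_lin F != 0.
Proof.
apply/eqP => /(congr1 (fun p : {poly F} => p`_0)).
rewrite /half_lin coefB coefCM coef1 coefX coef0 /= mulr0 subr0.
by move/eqP; rewrite oner_eq0.
Qed.

(** With [y = z^2/4] the left side is the quotient of [(z-1)^q - y^q] by [z-1-y], hence
    [(z-1-y)^(q-1) = (-w^2)^(q-1)], and [q-1] is even. *)
Lemma sum_half_lin (F : finFieldType) : 2%:R != 0 :> F ->
  ('X - 1) ^+ (#|F| - 1) + \sum_(1 <= m < #|F|)
         ('X - 1) ^+ (#|F| - 1 - m) * 'X^(2 * m) * ((4%:R^-1) ^+ m)%:P
    = (half_lin F ^+ #|F|.-1) ^+ 2.
Proof.
move=> nz2; have F1 := finNzRing_gt1 F.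
have c1 : #|F| = #|F|.-1.+1 by rewrite prednK // (leq_trans _ F1).
pose y : {poly F} := (4%:R^-1)%:P * 'X^2.
have w2 : - half_lin F ^+ 2 = 'X - 1 - y.
  have := half_lin_sqr F 0 nz2; rewrite addr0 polyC0 oppr0 mul0r subr0 => <-.
  by rewrite /y; ring.
have nzw : - half_lin F ^+ 2 != 0 by rewrite oppr_eq0 expf_neq0 ?half_lin_neq0.
transitivity ((- half_lin F ^+ 2) ^+ #|F|.-1); last first.
  rewrite exprNn -signr_odd.
  have -> : odd #|F|.-1 = false by have := odd_card_finField F nz2; rewrite c1 /= => /negPf.
  by rewrite expr0 mul1r exprAC.
apply: (mulfI nzw); rewrite -exprS -c1 w2 poly_expq_sub subrXX; congr (_ * _).
rewrite -(big_mkord xpredT (fun i => ('X - 1) ^+ (#|F|.-1 - i) * y ^+ i)).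
rewrite [RHS]big_ltn ?(ltnW F1) // subn0 expr0 mulr1 subn1; congr (_ + _).
apply: eq_bigr => i _; rewrite /y exprMn -polyC_exp -exprM -mulrA.
by congr (_ * _); rewrite mulrC.
Qed.

(** Multiplied by [z], with [u = z - z^q], the left side is [u + u^q], which telescopes to
    [z - z^(q^2)]. *)
Lemma polyB_factor (F : finFieldType) :
  (1 - 'X^(#|F|.-1)) * (1 + ('X - 'X^#|F|) ^+ #|F|.-1)
    = 1 - 'X^((#|F| ^ 2).-1) :> {poly F}.
Proof.
have F1 := finNzRing_gt1 F.
have c1 : #|F| = #|F|.-1.+1 by rewrite prednK // (leq_trans _ F1).
have cM : (#|F| * #|F| = (#|F| ^ 2).-1.+1)%N by nia.
have nzX : 'X != 0 :> {poly F} by rewrite polyX_eq0.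
apply: (mulfI nzX); rewrite mulrA.
have -> : 'X * (1 - 'X^(#|F|.-1)) = 'X - 'X^#|F| :> {poly F}.
  by rewrite mulrBr mulr1 -exprS -c1.
rewrite mulrDr mulr1 -exprS -c1 poly_expq_sub -exprM cM exprS; ring.
Qed.

(** * Summation over nonzero [b] *)

(** By [cofEP] and [cofKP], the summand is [(1 - z^(q^2-1)) / g_b]. *)
Definition sum_kernel (F : finFieldType) : {poly F} :=
  \sum_(b : F | b != 0) half_lin F * cofE F b * cofK F.

Lemma sum_kernelE (F : finFieldType) : 2%:R != 0 :> F ->
  (1 + 'X^(#|F|.-1) - 'X^#|F|) * sum_kernel F
    = - (1 + ('X - 'X^#|F|) ^+ #|F|.-1) * (half_lin F ^+ #|F|.-1) ^+ 2.
Proof.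
move=> nz2; have F1 := finNzRing_gt1 F.
have nzZ : 1 - 'X^(#|F|.-1) != 0 :> {poly F}.
  rewrite -oppr_eq0 opprB -size_poly_eq0 size_XnsubC //.
  by case: #|F| F1 => [|[]].
have e : (half_lin F ^+ #|F|.-1) ^+ 2 = half_lin F ^+ 2 * (half_lin F ^+ 2) ^+ #|F|.-2.
  by rewrite exprAC -exprS; case: #|F| F1 => [|[]].
apply: (mulfI nzZ).
rewrite mulrA [RHS]mulrA mulrN polyB_factor // -cofKP //.
rewrite -half_lin_mulB -half_lin_mulD //.
rewrite /sum_kernel -big_distrl -big_distrr /= sum_cofE // [X in _ = _ * X]e.
by ring.
Qed.

Definition dickson_sum_poly (F : finFieldType) (k : nat) : {poly F} :=
  \sum_(b : F | b != 0) \poly_(n < (#|F| ^ 2).-1.+1)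
     (if n == 0%N then 0 else (dickson_rev F k n).[4%:R^-1 + b]).

(** The last term gets a plus sign because it is subtracted once for each of the [q - 1 = -1] values
    of [b]. *)
Lemma dickson_sum_polyE (F : finFieldType) (k : nat) : 2%:R != 0 :> F ->
  dickson_sum_poly F k
    = ((2%:R - k%:R)%:P + (k%:R - 1)%:P * 'X) * sum_kernel F
      + (2%:R - k%:R)%:P * (1 - 'X^((#|F| ^ 2).-1)).
Proof.
move=> nz2; have F1 := finNzRing_gt1 F; rewrite /dickson_sum_poly /sum_kernel.
rewrite big_distrr /= -[_%:P * (1 - _)]opprK -[X in _ = _ - X]sum_neq0_const.
rewrite -sumrB; apply: eq_bigr => b bnz.
have M0 : (0 < (#|F| ^ 2).-1)%N by move: #|F| F1 => q q1; nia.
rewrite -(@dickson_rev_period_poly _ _ _ _ (half_lin F * cofE F b * cofK F)) //.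
by rewrite -cofKP // -(cofEP _ b) // -!mulrA [LHS]mulrCA.
Qed.

(** The algebra of [polyC_genE] with powers as atoms: [Z = z^(q-1)], [T = z^(q^2-1)],
    [O = (z-1)^(q-1)], [V = w^(2(q-1))], [beta = (z-z^q)^(q-1)], [d = 2-k]; [J] is the geometric sum
    and [H] is [sum_kernel]. *)
Lemma gen_identity (R : idomainType) (x J O V d H Z T beta : R) :
  1 - x != 0 ->
  (1 - x) * J = x * (1 - T) ->
  (1 - x) * O = 1 - x * Z ->
  (1 - Z) * (1 + beta) = 1 - T ->
  (1 + Z - x * Z) * H = - (1 + beta) * V ->
  (1 + Z - x * Z) * J - (Z ^+ 2 + (- O + V)) * ((d + (1 - d) * x) * (-1 - beta))
    = - ((1 + Z - x * Z) * ((d + (1 - d) * x) * H + d * (1 - T))).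
Proof.
move=> nzx EJ EO EB EH; apply: (mulfI nzx).
transitivity ((1 + Z - x * Z) * ((1 - x) * J)
  - ((1 - x) * Z ^+ 2 - (1 - x) * O + (1 - x) * V)
    * ((d + (1 - d) * x) * (-1 - beta))); first by ring.
transitivity (- ((1 - x) * (d + (1 - d) * x) * ((1 + Z - x * Z) * H)
  + (1 - x) * (1 + Z - x * Z) * d * (1 - T))); last by ring.
by rewrite EJ EO EH -EB; ring.
Qed.

Lemma polyC_genE (F : finFieldType) (k : nat) : 2%:R != 0 :> F ->
  polyC_gen F #|F| k
    = - ((1 + 'X^(#|F|.-1) - 'X^#|F|) * dickson_sum_poly F k).
Proof.
move=> nz2; have F1 := finNzRing_gt1 F.
have c1 : #|F| = #|F|.-1.+1 by rewrite prednK // (leq_trans _ F1).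
have cM : (#|F| ^ 2 = (#|F| ^ 2).-1.+1)%N by nia.
have nzX : 1 - 'X != 0 :> {poly F}.
  by rewrite -oppr_eq0 opprB -size_poly_eq0 size_XsubC.
have EG := canRL (addKr _) (sum_half_lin F nz2).
have EJ := sub1_mul_sum_expr _ ('X : {poly F}) (#|F| ^ 2).-1.
have EO : (1 - 'X) * ('X - 1) ^+ (#|F| - 1) = 1 - 'X * 'X^(#|F|.-1) :> {poly F}.
  rewrite -opprB mulNr subn1 -!exprS -c1.
  by rewrite poly_expq_sub expr1n opprB.
have EB := polyB_factor F; have EH := sum_kernelE F nz2.
have kd : (k%:R - 1)%:P = 1 - (2%:R - k%:R)%:P :> {poly F}.
  by rewrite -polyC1 -polyCB; congr _%:P; ring.
rewrite -cM in EJ.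
rewrite /polyC_gen {}EG /polyB dickson_sum_polyE // kd.
rewrite mulnC exprM !subn1 in EO *.
have EY : 'X^#|F| = 'X * 'X^(#|F|.-1) :> {poly F} by rewrite -exprS -c1.
rewrite EY in EB EH *.
exact: gen_identity nzX EJ EO EB EH.
Qed.

(* The sum over all [a] different from [1/4], written as [a = 1/4 + b]. *)
Definition punctured_sum (F : finFieldType) (k n : nat) : F :=
  \sum_(b : F | b != 0) (dickson_rev F k n).[4%:R^-1 + b].

(** * Comparison of coefficients *)

Lemma coef_dickson_sum_poly (F : finFieldType) (k n : nat) :
  (dickson_sum_poly F k)`_n
    = if (0 < n < #|F| ^ 2)%N then punctured_sum F k n else 0.
Proof.
have F1 := finNzRing_gt1 F.
have cM : (#|F| ^ 2 = (#|F| ^ 2).-1.+1)%N by rewrite prednK // expn_gt0 ltnW.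
rewrite /dickson_sum_poly coef_sum [in RHS]cM; case: n => [|n].
  by rewrite big1 // => b _; rewrite coef_poly.
rewrite andTb; case: ifP => hn.
  by apply: eq_bigr => b _; rewrite coef_poly hn.
by rewrite big1 // => b _; rewrite coef_poly hn.
Qed.

Lemma sum_dickson_rev (F : finFieldType) (k n : nat) : 2%:R != 0 :> F ->
  \sum_(a : F) (dickson_rev F k n).[a]
    = punctured_sum F k n + (k%:R * (n%:R - 1) + 2%:R) / 2%:R ^+ n.
Proof.
move=> nz2; rewrite (reindex_inj (addrI 4%:R^-1)) (bigD1 0) //= addr0.
by rewrite dickson_rev_quarter // addrC.
Qed.

Lemma coef_polyC_gen (F : finFieldType) (k n : nat) : 2%:R != 0 :> F ->
  (polyC_gen F #|F| k)`_n
    = - (dickson_sum_poly F k)`_n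
      - (if (n < #|F|.-1)%N then 0 else (dickson_sum_poly F k)`_(n - #|F|.-1))
      + (if (n < #|F|)%N then 0 else (dickson_sum_poly F k)`_(n - #|F|)).
Proof.
move=> nz2; rewrite polyC_genE // coefN !mulrDl mulNr mul1r !coefD coefN.
by rewrite !coefXnM opprB addrC opprD.
Qed.

Theorem theorem4p2 (p e q k : nat) (F : finFieldType) (c : nat -> F)
    (p_prime : prime p) (p_odd : odd p) (e_gt0 : (0 < e)%N)
    (q_def : q = (p ^ e)%N) (cardF : #|F| = q) (k_le : (k <= p - 1)%N)
    (c_def : \sum_(1 <= i < q ^ 2 + q) c i *: 'X^i = polyC_gen F q k) :
  let S (n : nat) : F := \sum_(a : F) (dickson_rev F k n).[a] in
  [/\ (forall j : nat, (1 <= j <= q - 1)%N ->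
         S j = - c j + (k%:R * (j%:R - 1) + 2%:R) / 2%:R ^+ j),
      S q = c 1%N - c q + (2%:R - k%:R) / 2%:R ^+ q,
      (forall l j : nat, (1 <= l <= q - 2)%N -> (1 <= j <= q - 1)%N ->
         S (l * q + j)%N
         = S ((l - 1) * q + j)%N - S ((l - 1) * q + j + 1)%N
           - c (l * q + j)%N
           + ((k%:R * j%:R + 2%:R) * (1 - 2%:R ^+ q + 2%:R ^+ (q - 1))
              + k%:R * (2%:R ^+ q - 1)) / 2%:R ^+ (l * q + j)),
      (forall l : nat, (2 <= l <= q - 2)%N ->
         S (l * q)%N
         = S ((l - 1) * q)%N - S ((l - 1) * q + 1)%N - c (l * q)%N
           + ((k%:R - 2%:R) * (2%:R ^+ q - 1) + 2%:R ^+ q)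
             / 2%:R ^+ (l * q))
    & (forall j : nat, (j <= q - 1)%N ->
         S (q ^ 2 - q + j)%N
         = \sum_(j <= i < q) c (q ^ 2 + i)%N
           + (k%:R * (j%:R - 1) + 2%:R) / 2%:R ^+ (q ^ 2 - q + j))].
Proof.
move=> S.
have q_odd : odd q by rewrite q_def oddX p_odd orbT.
have q_gt1 : (1 < q)%N by rewrite -cardF finNzRing_gt1.
have q_gt2 : (2 < q)%N by case: q q_odd q_gt1 {q_def cardF c_def} => [|[|[|]]].
have pF : p \in [pchar F] by apply: (@card_finPcharP F p e); rewrite ?cardF.
have nz2 : 2%:R != 0 :> F.
  rewrite -(dvdn_pcharf pF); apply: contraL p_odd => /(@dvdn_leq p 2 isT).
  by case: p p_prime {pF q_def k_le} => [|[|[|]]].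
have q0 : q%:R = 0 :> F by rewrite -cardF finField_card_natr.
have two_q : 2%:R ^+ q = 2%:R :> F by rewrite -cardF expf_card.
have two_q1 : 2%:R ^+ (q - 1) = 1 :> F.
  by rewrite subn1 -cardF expf_card_pred.
(* [T] is the punctured sum for [0 < n < q ^ 2] but 0 elsewhere; these zeros settle the boundary
   cases of (i), (ii) and (v). *)
pose T n := (dickson_sum_poly F k)`_n.
have T0 n : (n == 0%N) || (q ^ 2 <= n)%N -> T n = 0.
  by rewrite /T coef_dickson_sum_poly cardF => hn; rewrite ifN //; lia.
have ST n : (0 < n < q ^ 2)%N -> S n = T n + (k%:R * (n%:R - 1) + 2%:R) / 2%:R ^+ n.
  by move=> hn; rewrite /S sum_dickson_rev // /T coef_dickson_sum_poly cardF hn.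
have cE n : (0 < n < q ^ 2 + q)%N -> c n = - T n
      - (if (n < q - 1)%N then 0 else T (n - (q - 1))%N)
      + (if (n < q)%N then 0 else T (n - q)%N).
  move=> hn; rewrite subn1 -cardF -coef_polyC_gen // cardF -c_def coef_sum.
  rewrite (bigD1_seq n) ?iota_uniq ?mem_index_iota //= coefZ coefXn eqxx mulr1.
  rewrite big1 ?addr0 // => i /negPf ni.
  by rewrite coefZ coefXn eq_sym ni mulr0.
split.
- move=> j hj; have hj2 : (j < q ^ 2)%N by nia.
  rewrite ST ?cE; [|lia..].
  have -> : (j < q)%N by lia.
  (* Only [j = q - 1] reaches the middle term, which is then [T 0 = 0]. *)
  case: ltnP => [_|h]; first by ring.
  by rewrite [T (j - _)%N]T0; [ring|lia].
(* Here [c 1 = - T 1] and [c q = - T q - T 1], so [c 1 - c q = T q]. *)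
- rewrite ST; last by nia.
  rewrite !cE; [|nia..].
  have -> : (1 < q - 1)%N by lia.
  rewrite ltnn q_gt1 subnn [T 0%N]T0 // ifN; last by lia.
  have -> : (q - (q - 1) = 1)%N by lia.
  by rewrite q0; ring.
- move=> l j hl hj; have hn : (l * q + j < q ^ 2)%N by nia.
  have hn' : (l * q + j = (l - 1) * q + j + q)%N.
    by case: l hl {hn} => // l _; rewrite subn1 mulSn -addnA addnC.
  rewrite cE; last by lia.
  rewrite !ST; [|nia..].
  rewrite !ifN; [|nia..].
  have -> : (l * q + j - q = (l - 1) * q + j)%N
    by rewrite hn'; move: ((l - 1) * q)%N => A; lia.
  have -> : (l * q + j - (q - 1) = (l - 1) * q + j + 1)%N
    by rewrite hn'; move: ((l - 1) * q)%N => A; lia.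
  rewrite hn' two_q two_q1 !natrD !natrM q0 !exprD two_q expr1.
  by field; rewrite ?nz2 !expf_neq0 ?nz2.
(* As [l >= 2], the index [(l - 1) * q] is positive, so [ST] applies to it. *)
- move=> l hl; have hn : (l * q < q ^ 2)%N by nia.
  have hn' : (l * q = (l - 1) * q + q)%N.
    by case: l hl {hn} => // l _; rewrite subn1 mulSn addnC.
  rewrite cE; last by lia.
  rewrite !ST; [|nia..].
  rewrite !ifN; [|nia..].
  have -> : (l * q - q = (l - 1) * q)%N
    by rewrite hn'; move: ((l - 1) * q)%N => A; lia.
  have -> : (l * q - (q - 1) = (l - 1) * q + 1)%N
    by rewrite hn'; move: ((l - 1) * q)%N => A; lia.
  rewrite hn' two_q !natrD !natrM q0 !exprD two_q expr1.
  by field; rewrite ?nz2 !expf_neq0 ?nz2.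
- move=> j hj; rewrite ST; last by nia.
  rewrite natrD natrB; last by nia.
  rewrite natrX q0 expr0n /= subrr add0r; congr (_ + _).
  (* From index [q ^ 2] on, the leading term of [cE] is 0 and each [c] is a difference of
     consecutive [T]; the sum telescopes down from [T (q ^ 2) = 0]. *)
  transitivity (\sum_(j <= i < q) (T (q ^ 2 - q + i)%N - T (q ^ 2 - q + i.+1)%N)).
    rewrite (@telescope_sumr_eq _ _ _ (fun i => - T (q ^ 2 - q + i)%N)) ?opprK.
    - by rewrite [T (_ + q)%N]T0 ?oppr0 ?add0r //; nia.
    - lia.
    - by move=> i _; rewrite opprK addrC.
  apply: eq_big_nat => i hi; rewrite cE; last by lia.
  rewrite [T (q ^ 2 + i)%N]T0; last by lia.
  rewrite !ifN; [|nia..].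
  have -> : (q ^ 2 + i - q = q ^ 2 - q + i)%N by nia.
  have -> : (q ^ 2 + i - (q - 1) = q ^ 2 - q + i.+1)%N by nia.
  by ring.
Qed.
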